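(* There exists a measure-preserving rank-one transformation $T$ on a $\sigma$-finite measure space that is not weakly doubly ergodic but is ergodic with isometric coefficients.
   Context: All measure spaces $(X,\mathcal B,\mu)$ are standard Borel spaces with a nonatomic $\sigma$-finite measure; transformations are invertible (on a set of full measure, with measurable inverse). A transformation $T$ is nonsingular if it is measurable and $\mu(A)=0$ if and only if $\mu(T^{-1}A)=0$. Weakly doubly ergodic: a nonsingular transformation $(X,\mu,T)$ is weakly doubly ergodic if for any two measurable sets $A,B$ of positive measure there exists $n\in\mathbb Z$ such that $\mu(T^nA\cap A)>0$ and $\mu(T^nA\cap B)>0$. Ergodic with isometric coefficients: a nonsingular transformation $(X,\mu,T)$ is ergodic with isometric coefficients if for every separable metric space $Y$, every invertible isometry $S:Y\to Y$, and every Borel map $\phi:X\to Y$ with $S\circ\phi=\phi\circ T$ $\mu$-a.e., the map $\phi$ is constant $\mu$-a.e. Measure-preserving rank-one transformation: A column is a finite ordered collection $C_k=\{C_k(0),\dots,C_k(h_k-1)\}$ of pairwise disjoint intervals (levels) of the same finite positive length; $h_k$ is its height. The column map $T_{C_k}$ sends $C_k(i)$ to $C_k(i+1)$ by translation for $0\le i<h_k-1$ and is undefined on the top level $C_k(h_k-1)$. A rank-one construction is specified by integers $r_k\ge 2$ ($k\ge0$) and nonnegative integers $s(k,i)$, $0\le i\le r_k-1$. The column $C_0$ is a single interval. Given $C_k$, cut each level into $r_k$ subintervals of equal length, giving subcolumns $C_{k,0},\dots,C_{k,r_k-1}$ (ordered left to right); place $s(k,i)$ new disjoint intervals (spacers)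 of the same length as the subintervals on top of $C_{k,i}$; then stack the resulting subcolumns, the $(i+1)$-st directly above the $i$-th, to obtain $C_{k+1}$. The map $T_{C_{k+1}}$ extends $T_{C_k}$. The space $X$ is the union of all levels of all columns, with Lebesgue measure, and $T$ is the limit of the maps $T_{C_k}$. *)

(* Defs.v *)
From HB Require Import structures.
From mathcomp Require Import all_boot all_order all_algebra.
From mathcomp Require Import all_classical all_reals all_analysis.
Set Implicit Arguments.
Unset Strict Implicit.
Unset Printing Implicit Defensive.
Import Order.TTheory GRing.Theory Num.Theory.
Import numFieldNormedType.Exports.
Local Open Scope classical_set_scope.
Local Open Scope ring_scope.

(* A nonsingular transformation, invertible on a set of full measure: [tinv] is
   a measurable inverse up to null sets.  Its nonsingularity follows from that
   of [tmap], so it is unique up to null sets and so are all its iterates. *)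
Record nonsingular_transformation (R : realType) (d : measure_display)
    (X : measurableType d) (mu : {measure set X -> \bar R}) := Nonsingular {
  tmap :> X -> X ;
  tinv : X -> X ;
  measurable_tmap : measurable_fun setT tmap ;
  measurable_tinv : measurable_fun setT tinv ;
  tmapK : {ae mu, forall x, tinv (tmap x) = x} ;
  tinvK : {ae mu, forall x, tmap (tinv x) = x} ;
  tmap_nonsingular : forall A, measurable A ->
    (mu A = 0%E <-> mu (tmap @^-1` A) = 0%E) }.

Section transformations.
Context (R : realType) (d : measure_display) (X : measurableType d)
  (mu : {measure set X -> \bar R}).
Implicit Types T : nonsingular_transformation mu.

Definition measure_preserving T : Prop :=
  forall A, measurable A -> mu (T @^-1` A) = mu A.

Definition iterz T (n : int) (x : X) : X :=
  match n with
  | Posz m => iter m T x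
  | Negz m => iter m.+1 (tinv T) x
  end.

(* T^n A, written as the preimage of A under T^(-n).  It is measurable, and it
   does not depend on the values of T on the null set where T fails to be
   invertible; the direct image of A need not have either property. *)
Definition imagez T (n : int) (A : set X) : set X := iterz T (- n) @^-1` A.

Definition weakly_doubly_ergodic T : Prop :=
  forall A B : set X, measurable A -> measurable B ->
    (0 < mu A)%E -> (0 < mu B)%E ->
    exists n : int, (0 < mu (imagez T n A `&` A))%E /\
                    (0 < mu (imagez T n A `&` B))%E.

Definition separable (Y : topologicalType) : Prop :=
  exists2 D : set Y, countable D & dense D.

Definition isometry (Y : metricType R) (S : Y -> Y) : Prop :=
  forall y z, mdist (S y) (S z) = mdist y z.

Definition borel_fun (Y : topologicalType) (phi : X -> Y) : Prop :=
  forall B : set Y, <<s @open Y >> B -> measurable (phi @^-1` B).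

Definition ergodic_isometric_coefficients T : Prop :=
  forall (Y : metricType R) (S : Y -> Y) (phi : X -> Y),
    separable Y -> isometry S -> bijective S -> borel_fun phi ->
    {ae mu, forall x, S (phi x) = phi (T x)} ->
    exists c : Y, {ae mu, forall x, phi x = c}.

End transformations.

(* The i-th level of a column is the interval [b, b + width[ where b is the
   i-th entry of [bases] (bottom level first). *)
Record column (R : realType) := Column { width : R ; bases : seq R }.

Section columns.
Context (R : realType).
Implicit Types C : column R.

Definition height C : nat := size (bases C).

Definition level C (i : nat) : set R :=
  `[(bases C)`_i, (bases C)`_i + width C[%classic.

Definition is_column C : Prop :=
  0 < width C /\ trivIset [set i | (i < height C)%N] (level C).

(* The graph of the (partial) column map. *)
Definition column_map C (x y : R) : Prop :=
  exists i : nat, [/\ (i.+1 < height C)%N, level C i x &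
                      y = x + ((bases C)`_i.+1 - (bases C)`_i)].

(* [sp i j] is the left endpoint of the j-th spacer put on the i-th subcolumn;
   only the values with i < r and j < s i are used. *)
Definition cut_and_stack C (r : nat) (s : nat -> nat) (sp : nat -> nat -> R) :=
  let w := width C / r%:R in
  Column w (flatten [seq [seq b + i%:R * w | b <- bases C] ++ mkseq (sp i) (s i)
                    | i <- iota 0 r]).

(* As the levels of C k.+1 are pairwise disjoint, the spacers are disjoint from
   each other and from all the levels of C k. *)
Definition rank_one_construction (C : nat -> column R)
    (r : nat -> nat) (s : nat -> nat -> nat) : Prop :=
  [/\ height (C 0%N) = 1%N,
      forall k, is_column (C k),
      forall k, (2 <= r k)%N &
      forall k, exists sp : nat -> nat -> R,
        C k.+1 = cut_and_stack (C k) (r k) (s k) sp].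

Definition rank_one_space (C : nat -> column R) : set R :=
  \bigcup_k \bigcup_(i in [set i | (i < height (C k))%N]) level (C k) i.

Lemma measurable_rank_one_space (C : nat -> column R) :
  measurable (rank_one_space C : set (measurableTypeR R)).
Proof.
apply: bigcup_measurable => k _; apply: bigcup_measurable => i _.
exact: measurable_itv.
Qed.

(* Lebesgue measure on the union of the levels, as a measure on the Borel sets
   of the real line for which the complement of this union is null. *)
Definition rank_one_measure (C : nat -> column R) :
    {measure set (measurableTypeR R) -> \bar R} :=
  mrestr lebesgue_measure (measurable_rank_one_space C).

(* T extends every column map; these determine T almost everywhere on the union
   of the levels. *)
Definition rank_one_limit (C : nat -> column R) (T : R -> R) : Prop :=
  forall k x y, column_map (C k) x y -> T x = y.

End columns.

(* Main.v *)
(* The columns have r_k = 2, s(k,0) = h_k + k and s(k,1) = 0, so that the second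
   subcolumn of C_k starts at height p_k = 2 h_k + k of C_(k+1), and
   p_(k+1) = 3 p_k + 1.

   Not weakly doubly ergodic: the copies of C_0 in C_k sit at the heights
   sum_(j < k) d_j p_j with d_j in {0, 1}, and the p_j grow so fast that 1 is not
   a difference of two differences of such heights.  Take for A
   the level of C_0 and for B level 1 of C_1, which is contained in T A.

   Isometric coefficients: if phi^-1(ball d e) fills most of a level of C_k, then
   some points of it return to it after p_k steps, and some after p_(k+1) steps.
   As phi intertwines T and S, both S^(p_k) and S^(p_(k+1)) move d by at most
   2 e, and so S, with 1 = p_(k+1) - 3 p_k, moves d by at most 8 e.  Hence phi is
   T-invariant, and it is constant by ergodicity. *)

Require Import Defs.
From mathcomp Require Import all_boot all_order all_algebra.
From mathcomp Require Import all_classical all_reals all_analysis.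
From mathcomp Require Import measurable_realfun zify lra.
Import Order.TTheory GRing.Theory Num.Theory.
Import numFieldNormedType.Exports.
Local Open Scope classical_set_scope.
Local Open Scope ring_scope.
Set Implicit Arguments.
Unset Strict Implicit.
Unset Printing Implicit Defensive.

(** * Combinatorics of the columns *)

Fixpoint ht (k : nat) : nat :=
  if k is k'.+1 then (3 * ht k' + k')%N else 1%N.

(* The second subcolumn of C_k starts at height [rtime k] of C_(k+1). *)
Definition rtime (k : nat) : nat := (2 * ht k + k)%N.

(** Encodes C_k by integer positions, bottom level first. Halving turns position m into 2 m and 2 m
    + 1; the spacers between the two subcolumns take the next free positions, from 2 h_k on. *)
Fixpoint slots (k : nat) : seq nat :=
  if k is k'.+1 then
    [seq (2 * m)%N | m <- slots k']
      ++ mkseq (fun j => 2 * ht k' + j)%N (ht k' + k')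
      ++ [seq (2 * m).+1 | m <- slots k']
  else [:: 0%N].

(* Level i of C_k is the dyadic interval [m 2^-k, (m + 1) 2^-k[ with
   m = slot k i. *)
Definition slot (k i : nat) : nat := nth 0%N (slots k) i.

Lemma size_slots k : size (slots k) = ht k.
Proof.
elim: k => //= k IH.
rewrite !size_cat !size_map size_iota IH; lia.
Qed.

Lemma rtimeS k : rtime k.+1 = (3 * rtime k).+1.
Proof. rewrite /rtime /=; lia. Qed.

Lemma htS k : ht k.+1 = (rtime k + ht k)%N.
Proof. rewrite /rtime /=; lia. Qed.

Lemma ht_gt k : (k < ht k)%N.
Proof. by elim: k => //= k IH; lia. Qed.

Lemma expn2_le_ht k : (2 ^ k <= ht k)%N.
Proof. by elim: k => //= k IH; rewrite expnS; lia. Qed.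

(** The halves of the old levels are the even and odd numbers below 2 h_k, and the spacers continue
    them without gap. So the levels of C_k tile the interval [0, h_k 2^-k[. *)
Lemma mem_slots k m : (m \in slots k) = (m < ht k)%N.
Proof.
elim: k m => [|k IH] m; first by rewrite inE; case: m.
have mul2E : ((m \in [seq 2 * n | n <- slots k]) = ~~ odd m && (m./2 < ht k))%N.
  apply/mapP/andP => [[n]|[om hm]]; first by rewrite IH => ? ->; lia.
  by exists m./2; rewrite ?IH //; lia.
have mul2SE :
    ((m \in [seq (2 * n).+1 | n <- slots k]) = odd m && (m./2 < ht k))%N.
  apply/mapP/andP => [[n]|[om hm]]; first by rewrite IH => ? ->; lia.
  by exists m./2; rewrite ?IH //; lia.
have spE : ((m \in mkseq (fun j => 2 * ht k + j) (ht k + k)) =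
    (2 * ht k <= m < 2 * ht k + (ht k + k)))%N.
  apply/mapP/idP => [[n]|hm]; first by rewrite mem_iota => ? ->; lia.
  by exists (m - 2 * ht k)%N; rewrite ?mem_iota; lia.
rewrite /= !mem_cat mul2E mul2SE spE; lia.
Qed.

Lemma uniq_slots k : uniq (slots k).
Proof.
have sl : slots k =i iota 0 (ht k) by move=> m; rewrite mem_slots mem_iota.
apply: (@leq_size_uniq _ (iota 0 (ht k))); first exact: iota_uniq.
- by move=> m; rewrite sl.
- by rewrite size_slots size_iota.
Qed.

Lemma slot_inj k i j :
  (i < ht k)%N -> (j < ht k)%N -> slot k i = slot k j -> i = j.
Proof.
move=> hi hj /eqP.
by rewrite /slot nth_uniq ?size_slots ?uniq_slots // => /eqP.
Qed.

Lemma slot_left k i : (i < ht k)%N -> slot k.+1 i = (2 * slot k i)%N.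
Proof.
move=> hi; rewrite /slot /= nth_cat size_map size_slots hi.
by rewrite (nth_map 0%N) // size_slots.
Qed.

Lemma slot_spacer k j :
  (j < ht k + k)%N -> slot k.+1 (ht k + j) = (2 * ht k + j)%N.
Proof.
move=> hj; rewrite /slot /= nth_cat size_map size_slots ltnNge leq_addr /=.
by rewrite addKn nth_cat size_mkseq hj nth_mkseq.
Qed.

Lemma slot_right k i :
  (i < ht k)%N -> slot k.+1 (i + rtime k) = (2 * slot k i).+1.
Proof.
move=> hi; rewrite /slot /= nth_cat size_map size_slots ifF; last first.
  by rewrite /rtime; lia.
rewrite nth_cat size_mkseq ifF; last by rewrite /rtime; lia.
rewrite (_ : _ - _ - _ = i)%N; last by rewrite /rtime; lia.
by rewrite (nth_map 0%N) // size_slots.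
Qed.

Lemma split_index k i : (i < ht k.+1)%N ->
  [\/ (i < ht k)%N,
      exists2 j, (j < ht k + k)%N & i = (ht k + j)%N |
      exists2 j, (j < ht k)%N & i = (j + rtime k)%N].
Proof.
move=> hi; have [h1|h1] := ltnP i (ht k); first by constructor 1.
have [h2|h2] := ltnP i (rtime k).
  by constructor 2; exists (i - ht k)%N; move: h2; rewrite /rtime; lia.
by constructor 3; exists (i - rtime k)%N; move: hi; rewrite htS; lia.
Qed.

(** The top level of C_(k+1) is the right half of that of C_k, so the top levels shrink towards 1
    from the left. *)
Lemma slot_top k : (slot k (ht k).-1).+1 = (2 ^ k)%N.
Proof.
elim: k => // k IH; have := ht_gt k => hk.
rewrite htS (_ : _.-1 = (ht k).-1 + rtime k)%N; last lia.
rewrite slot_right; last lia.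
by rewrite expnS -IH; lia.
Qed.

Lemma slot0 k : slot k 0 = 0%N.
Proof.
by elim: k => // k IH; rewrite slot_left ?IH //; have := ht_gt k; lia.
Qed.

(** * Heights of the copies of C_0 in C_k, by their digits *)

Inductive descendant : nat -> nat -> Prop :=
| Descendant0 : descendant 0 0
| DescendantL k i : descendant k i -> descendant k.+1 i
| DescendantR k i : descendant k i -> descendant k.+1 (i + rtime k).

Lemma descendant_lt k i : descendant k i -> (i < ht k)%N.
Proof. by elim=> {k i}[|k i _ IH|k i _ IH] //; rewrite htS /rtime; lia. Qed.

Lemma descendantS k i : descendant k.+1 i ->
  exists2 j, descendant k j & i = j \/ i = (j + rtime k)%N.
Proof.
by move=> d; inversion d; subst; [exists i|exists i0]; rewrite //; [left|right].
Qed.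

(* Top digits that do not cancel contribute at least [rtime k], while lower
   digits contribute at most [2 * (ht k - 1)], which is smaller by [k + 2]. *)
Lemma descendant_diff k a a' b b' :
  descendant k a -> descendant k a' -> descendant k b -> descendant k b' ->
  (a + b' <> a' + b + 1)%N.
Proof.
elim: k a a' b b' => [|k IH] a a' b b'.
  move=> /descendant_lt /= ? /descendant_lt /= ?.
  by move=> /descendant_lt /= ? /descendant_lt /= ?; lia.
move=> /descendantS[a1 da ha] /descendantS[a1' da' ha'].
move=> /descendantS[b1 db hb] /descendantS[b1' db' hb'].
have := IH _ _ _ _ da da' db db'.
move: (descendant_lt da) (descendant_lt da') (descendant_lt db).
by move: (descendant_lt db') ha ha' hb hb'; rewrite /rtime; lia.
Qed.

(** These positions are the ones inside [0, 1[, the interval of C_0. Spacers do not occur among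
    them: they start at position 2 h_k, which is at least 2^(k+1). *)
Lemma descendant_slot k i :
  (i < ht k)%N -> (slot k i < 2 ^ k)%N -> descendant k i.
Proof.
elim: k i => [|k IH] i; first by case: i => //; constructor.
rewrite expnS => /split_index[hi|[j hj ->]|[j hj ->]].
- by rewrite slot_left // => h; apply: DescendantL; apply: IH => //; lia.
- by rewrite slot_spacer //; have := expn2_le_ht k; lia.
- by rewrite slot_right // => h; apply: DescendantR; apply: IH => //; lia.
Qed.

(** These positions fill [1, 3/2[, which is level 1 of C_1 and sits right above the left half of
    C_0. Later spacers start at 3/2 or beyond, so each cut only copies pairs of heights j, j + 1. *)
Lemma descendant_slot_shift k i : (i < ht k.+1)%N ->
  (2 ^ k.+1 <= slot k.+1 i)%N -> (slot k.+1 i < 3 * 2 ^ k)%N ->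
  exists2 j, descendant k.+1 j & i = j.+1.
Proof.
elim: k i => [|k IH] i.
  case: i => [|[|[|]]] // _ _ _.
  by exists 0%N => //; apply: DescendantL; constructor.
rewrite expnS (expnS 2 k) => /split_index[hi|[j hj ->]|[j hj ->]].
- rewrite slot_left // => h1 h2.
  have [||j dj ->] := IH i hi; [rewrite expnS; lia|lia|].
  by exists j => //; apply: DescendantL.
- by rewrite slot_spacer //= => _; have := expn2_le_ht k; lia.
- rewrite slot_right // => h1 h2.
  have [||j' dj ->] := IH j hj; [rewrite expnS; lia|lia|].
  by exists (j' + rtime k.+1)%N; rewrite ?addSn //; apply: DescendantR.
Qed.

(** * The transformation *)

Section realization.
Context (R : realType).
Implicit Types (x y : R).
Local Notation lambda := (@lebesgue_measure R).

Definition lwidth (k : nat) : R := 2 ^- k.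

Definition tower (k : nat) : column R :=
  Column (lwidth k) [seq m%:R * lwidth k | m <- slots k].

Lemma lwidth_gt0 k : 0 < lwidth k.
Proof. by rewrite invr_gt0 exprn_gt0. Qed.

Lemma lwidthS k : lwidth k = 2 * lwidth k.+1.
Proof. by rewrite /lwidth exprS invfM mulrA divff ?mul1r. Qed.

Lemma mul_lwidth k (m : nat) : m%:R * lwidth k = (2 * m)%:R * lwidth k.+1.
Proof. by rewrite natrM (lwidthS k) mulrA [m%:R * 2]mulrC. Qed.

Lemma exp_lwidth k : (2 ^ k)%:R * lwidth k = 1.
Proof. by rewrite natrX divff // expf_neq0. Qed.

Lemma height_col k : height (tower k) = ht k.
Proof. by rewrite /height size_map size_slots. Qed.

Lemma base_col k i : (i < ht k)%N ->
  (bases (tower k))`_i = (slot k i)%:R * lwidth k.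
Proof. by move=> hi; rewrite (nth_map 0%N) // size_slots. Qed.

Lemma levelP k i x : (i < ht k)%N ->
  level (tower k) i x <->
  (slot k i)%:R * lwidth k <= x < (slot k i).+1%:R * lwidth k.
Proof.
move=> hi; rewrite /level base_col //= in_itv /=.
by rewrite -[in X in _ <-> X]natr1 mulrDl mul1r.
Qed.

Lemma natw_slot k (m n : nat) x :
  m%:R * lwidth k <= x < m.+1%:R * lwidth k ->
  n%:R * lwidth k <= x < n.+1%:R * lwidth k -> m = n.
Proof.
move=> /andP[m1 m2] /andP[n1 n2]; apply/eqP; rewrite eqn_leq.
move: (le_lt_trans m1 n2) (le_lt_trans n1 m2).
by rewrite !ltr_pM2r ?lwidth_gt0 // !ltr_nat !ltnS => -> ->.
Qed.

Lemma level_uniq k i j x : (i < ht k)%N -> (j < ht k)%N ->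
  level (tower k) i x -> level (tower k) j x -> i = j.
Proof.
move=> hi hj /(levelP _ hi) xi /(levelP _ hj) xj.
exact: slot_inj hi hj (natw_slot xi xj).
Qed.

Lemma tower_construction : rank_one_construction tower (fun=> 2%N)
  (fun k i => if i == 0%N then (ht k + k)%N else 0%N).
Proof.
split.
- exact: height_col.
- move=> k; split; first exact: lwidth_gt0.
  move=> i j /=; rewrite height_col => hi hj [x [xi xj]].
  exact: level_uniq hi hj xi xj.
- by [].
- move=> k; exists (fun _ j => (2 * ht k + j)%:R * lwidth k.+1).
  rewrite /cut_and_stack /tower /=.
  have w2 : lwidth k / 2 = lwidth k.+1.
    by rewrite (lwidthS k) mulrC mulrA mulVf ?mul1r.
  rewrite w2 /= !cats0 !map_cat -catA; congr Column; congr (_ ++ _ ++ _).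
  + rewrite -!map_comp; apply: eq_map => m /=.
    by rewrite mul0r addr0 -mul_lwidth.
  + by rewrite /mkseq -map_comp.
  + rewrite -!map_comp; apply: eq_map => m /=.
    by rewrite -natr1 mulrDl -mul_lwidth.
Qed.

(** * The column maps and their common extension *)

Definition step x y := exists k, column_map (tower k) x y.

Lemma column_mapP k x y : column_map (tower k) x y <->
  exists i, [/\ (i.+1 < ht k)%N, level (tower k) i x &
    y = x + ((slot k i.+1)%:R - (slot k i)%:R) * lwidth k].
Proof.
rewrite /column_map height_col; split=> -[i [hi xi ->]]; exists i; split => //.
  by rewrite !base_col ?mulrBl //; exact: ltnW.
by rewrite !base_col ?mulrBl //; exact: ltnW.
Qed.

Lemma level_translate k i j x : (i < ht k)%N -> (j < ht k)%N ->
  level (tower k) i x <->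
  level (tower k) j (x + ((slot k j)%:R - (slot k i)%:R) * lwidth k).
Proof.
move=> hi hj; rewrite (levelP _ hi) (levelP _ hj) -!natr1 !mulrDl !mul1r.
rewrite mulNr; split; lra.
Qed.

(** The two halves of a level lie p_k steps apart in the next column; this is what makes [rtime k] a
    return time. *)
Lemma level_split k i x : (i < ht k)%N -> level (tower k) i x <->
  level (tower k.+1) i x \/ level (tower k.+1) (i + rtime k) x.
Proof.
move=> hi; have hi1 : (i < ht k.+1)%N by rewrite htS; lia.
have hi2 : (i + rtime k < ht k.+1)%N by rewrite htS; lia.
rewrite (levelP _ hi) (levelP _ hi1) (levelP _ hi2) slot_left // slot_right //.
rewrite [X in X <= _ < _ <-> _]mul_lwidth [X in _ <= _ < X <-> _]mul_lwidth.
rewrite (_ : 2 * (slot k i).+1 = (2 * slot k i).+2)%N; last lia.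
rewrite -!natr1 !mulrDl !mul1r; have := lwidth_gt0 k.+1.
move: (lwidth k.+1) (_ * _) => v m v0.
split=> [/andP[h1 h2]|[]/andP[h1 h2]]; last 2 first.
- by apply/andP; split; lra.
- by apply/andP; split; lra.
have [h|h] := ltP x (m + v); [left|right]; apply/andP; split; lra.
Qed.

Lemma column_mapS k x y :
  column_map (tower k) x y -> column_map (tower k.+1) x y.
Proof.
move=> /column_mapP[i [hi xi ->]]; apply/column_mapP.
have hi' := ltnW hi.
case: ((level_split x hi').1 xi) => {}xi; [exists i|exists (i + rtime k)%N].
all: rewrite -?addSn htS; split => //; first by lia.
  by rewrite !slot_left // !mulrBl -!mul_lwidth.
by rewrite !slot_right // -!natr1 !mulrBl !mulrDl -!mul_lwidth; lra.
Qed.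

Lemma column_map_le k l x y : (k <= l)%N ->
  column_map (tower k) x y -> column_map (tower l) x y.
Proof.
move=> /subnK <-; elim: (l - k)%N => // n IH /IH.
exact: column_mapS.
Qed.

Lemma step_fun x y y' : step x y -> step x y' -> y = y'.
Proof.
move=> [k h] [k' h'].
move: (column_map_le (leq_maxl k k') h) (column_map_le (leq_maxr k k') h').
move=> /column_mapP[i [hi xi ->]] /column_mapP[j [hj xj ->]].
by rewrite (level_uniq (ltnW hi) (ltnW hj) xi xj).
Qed.

Lemma step_inj x x' y : step x y -> step x' y -> x = x'.
Proof.
move=> [k h] [k' h'].
move: (column_map_le (leq_maxl k k') h) (column_map_le (leq_maxr k k') h').
move=> /column_mapP[i [hi xi yi]] /column_mapP[j [hj xj yj]].
have yi1 := (level_translate x (ltnW hi) hi).1 xi.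
have yj1 := (level_translate x' (ltnW hj) hj).1 xj.
rewrite -yi in yi1; rewrite -yj in yj1.
have [ij] := level_uniq hi hj yi1 yj1.
by move: yi; rewrite yj ij => /addIr.
Qed.

Lemma level_le k l i x : (k <= l)%N -> (i < ht k)%N -> level (tower k) i x ->
  exists2 j, (j < ht l)%N & level (tower l) j x.
Proof.
move=> /subnK <- hi xi; elim: (l - k)%N => [|n [j hj xj]]; first by exists i.
case: ((level_split x hj).1 xj) => xj'; [exists j|exists (j + rtime (n + k))%N];
  by rewrite // addSn htS; lia.
Qed.

(** The default of [xget] is the point itself, so [fwd] and [bwd] are the identity where no step
    exists, as [measurable_piecewise] requires. In particular [bwd] fixes 0. *)
Definition fwd x : R := xget x [set y | step x y].
Definition bwd y : R := xget y [set x | step x y].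

Lemma fwdE x y : step x y -> fwd x = y.
Proof.
move=> xy; rewrite /fwd; apply: xget_unique => // z /= xz; exact: step_fun xz xy.
Qed.

Lemma bwdE x y : step x y -> bwd y = x.
Proof.
move=> xy; rewrite /bwd; apply: xget_unique => // z /= zy; exact: step_inj zy xy.
Qed.

Lemma tower_limit : rank_one_limit tower fwd.
Proof. by move=> k x y xy; apply: fwdE; exists k. Qed.

Local Notation space := (rank_one_space tower).

Lemma spaceP x :
  space x <-> exists k i, (i < ht k)%N /\ level (tower k) i x.
Proof.
split=> [[k _ [i /=]]|[k [i [hi xi]]]].
  by rewrite height_col => hi xi; exists k, i.
by exists k => //; exists i => //=; rewrite height_col.
Qed.

Lemma space_ge0 x : space x -> 0 <= x.
Proof.
move=> /spaceP[k [i [hi /(levelP _ hi)/andP[+ _]]]].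
by apply: le_trans; rewrite mulr_ge0 // ltW // lwidth_gt0.
Qed.

Lemma lwidth_lt (e : R) : 0 < e -> exists K, forall k, (K <= k)%N -> lwidth k < e.
Proof.
move=> e0; exists (Num.bound e^-1) => k hk.
rewrite -[e]invrK ltf_pV2 ?posrE ?exprn_gt0 ?invr_gt0 //.
apply: lt_trans (archi_boundP _) _; first by rewrite invr_ge0 ltW.
by rewrite -natrX ltr_nat (leq_ltn_trans hk) // ltn_expl.
Qed.

Lemma space_level x : space x -> exists K, forall k, (K <= k)%N ->
  exists2 i, (i < ht k)%N & level (tower k) i x.
Proof.
move=> /spaceP[K [i [hi xi]]]; exists K => k hk.
exact: level_le hk hi xi.
Qed.

Lemma levelI_step k i x : (i.+1 < ht k)%N -> level (tower k) i x ->
  step x (x + ((slot k i.+1)%:R - (slot k i)%:R) * lwidth k).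
Proof. by move=> hi xi; exists k; apply/column_mapP; exists i. Qed.

(* A point in the top level of C_k lies in [1 - 2^-k, 1[, so no point lies in
   the top levels of all columns. *)
Lemma step_total x : space x -> exists y, step x y.
Proof.
move=> sx; have [k hk] := space_level sx.
have [i hi xi] := hk _ (leqnn k).
have [hi1|hi1] := ltnP i.+1 (ht k); first by eexists; exact: levelI_step hi1 xi.
have x1 : 0 < 1 - x.
  have /andP[_] := (levelP _ hi).1 xi.
  rewrite (_ : i = (ht k).-1); last by lia.
  by rewrite slot_top exp_lwidth subr_gt0.
have [l hl] := lwidth_lt x1.
have [j hj xj] := hk _ (leq_maxl k l).
have [hj1|hj1] := ltnP j.+1 (ht (maxn k l)).
  by eexists; exact: levelI_step hj1 xj.
have /andP[+ _] := (levelP _ hj).1 xj.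
rewrite (_ : j = (ht (maxn k l)).-1); last by lia.
have := hl _ (leq_maxr k l); have := exp_lwidth (maxn k l).
by rewrite -slot_top -natr1 mulrDl mul1r; lra.
Qed.

(** The point 0 lies on the bottom level of every column, so no column map reaches it. *)
Lemma step_space x y : step x y -> [/\ space x, space y & y != 0].
Proof.
move=> [k] /column_mapP[i [hi xi ->]].
have xi1 := (level_translate x (ltnW hi) hi).1 xi.
split; [|by apply/spaceP; exists k, i.+1|].
  by apply/spaceP; exists k, i; rewrite ltnW.
have /andP[+ _] := (levelP _ hi).1 xi1.
apply: contraTneq => ->; rewrite -ltNge mulr_gt0 ?lwidth_gt0 // ltr0n lt0n.
apply/eqP => h; have := slot_inj hi (ltn_trans (ltn0Sn i) hi).
by rewrite h slot0 => /(_ erefl).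
Qed.

(** The bottom level of C_k is [0, 2^-k[, so a positive y has left it once 2^-k < y. *)
Lemma step_onto y : space y -> y != 0 -> exists x, step x y.
Proof.
move=> sy y0; have y_gt0 : 0 < y by rewrite lt_neqAle eq_sym y0 space_ge0.
have [k hk] := space_level sy; have [l hl] := lwidth_lt y_gt0.
have [[|j] hj yj] := hk _ (leq_maxl k l).
  have /andP[_] := (levelP _ hj).1 yj.
  by rewrite slot0 mul1r => h; have := hl _ (leq_maxr k l); lra.
move: (maxn k l) hj yj => m hj yj.
exists (y + ((slot m j)%:R - (slot m j.+1)%:R) * lwidth m), m; apply/column_mapP; exists j; split => //.
  exact/(level_translate _ hj (ltnW hj)).
by rewrite -addrA -mulrDl addrC; lra.
Qed.

Lemma fwd_step x : space x -> step x (fwd x).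
Proof. by move=> /step_total[y xy]; rewrite (fwdE xy). Qed.

Lemma bwd_step y : space y -> y != 0 -> step (bwd y) y.
Proof. by move=> sy /(step_onto sy)[x xy]; rewrite (bwdE xy). Qed.

Lemma fwd_space x : space x -> space (fwd x).
Proof. by move=> /fwd_step/step_space[]. Qed.

Lemma iter_fwd_space n x : space x -> space (iter n fwd x).
Proof. by move=> sx; elim: n => //= n; exact: fwd_space. Qed.

Lemma iter_fwd_level n k i x : (i + n < ht k)%N -> level (tower k) i x ->
  level (tower k) (i + n) (iter n fwd x) /\
  iter n fwd x = x + ((slot k (i + n))%:R - (slot k i)%:R) * lwidth k.
Proof.
elim: n => [|n IH] hn xi; first by rewrite addn0 subrr mul0r addr0.
have hn' : (i + n < ht k)%N by lia.
have [xn eqn] := IH hn' xi; rewrite addnS in hn *.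
rewrite iterS (fwdE (levelI_step hn xn)); split.
  exact: (level_translate _ hn' hn).1 xn.
by rewrite [in LHS]eqn; lra.
Qed.

(** * Measurability of the map and of its inverse *)

Local Notation mR := (measurableTypeR R).
Local Notation mu := (rank_one_measure tower).

Lemma measurable_addr (c : R) :
  measurable_fun [set: mR] (fun x : mR => (x + c : mR)).
Proof.
by apply: measurable_funD; [exact: measurable_id|exact: measurable_cst].
Qed.

(** The translated measure agrees with Lebesgue measure on half-open intervals, hence everywhere by
    uniqueness. *)
Lemma lebesgue_measure_addr (c : R) (A : set mR) : measurable A ->
  lambda ((fun x : mR => x + c : mR) @^-1` A) = lambda A.
Proof.
move=> mA.
change (pushforward lambda (fun x : mR => x + c : mR) A = lambda A).
apply/esym/lebesgue_measure_unique => //=; first exact: measurable_addr.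
move=> mf _ [[a b]] _ <-; rewrite /pushforward.
rewrite (_ : _ @^-1` _ = `]a - c, b - c]%classic); last first.
  by apply/seteqP; split=> x /=; rewrite !in_itv /= ltrBlDr lerBrDr.
rewrite !lebesgue_measure_itv /= !lte_fin ltrD2r; case: ifP => // _.
by rewrite -!EFinB; congr (_%:E); lra.
Qed.

(** The pieces may overlap, as levels of successive columns do: a preimage is still a countable
    union of translates cut down to pieces, plus a part where f is the identity. *)
Lemma measurable_piecewise (f : mR -> mR) (L : nat -> nat -> set mR)
    (c : nat -> nat -> R) :
  (forall k i, measurable (L k i)) ->
  (forall k i x, L k i x -> f x = x + c k i) ->
  (forall x, (forall k i, ~ L k i x) -> f x = x) ->
  measurable_fun setT f.
Proof.
move=> mL fL fN _ B mB; rewrite setTI.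
pose D := \bigcup_k \bigcup_i L k i.
have mD : measurable D by do 2 apply: bigcupT_measurable => ?; exact: mL.
rewrite (_ : f @^-1` B = (B `&` ~` D) `|` \bigcup_k \bigcup_i
    (L k i `&` ((fun x : mR => x + c k i : mR) @^-1` B))).
  apply: measurableU; first by apply: measurableI => //; exact: measurableC.
  do 2 apply: bigcupT_measurable => ?; apply: measurableI => //.
  by rewrite -[X in measurable X]setTI; apply: measurable_addr.
apply/seteqP; split => x /= Bx.
  have [[k _ [i _ Lx]]|nD] := pselect (D x).
    right; exists k => //; exists i => //; split => //=.
    by rewrite -(fL _ _ _ Lx).
  left; split => //; rewrite (fN x) // in Bx => k i Lx.
  by apply: nD; exists k => //; exists i.
case: Bx => [[Bx nD]|[k _ [i _ [Lx /= Bx]]]]; last by rewrite (fL _ _ _ Lx).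
by rewrite fN // => k i Lx; apply: nD; exists k => //; exists i.
Qed.

Lemma measurable_level k i : measurable (level (tower k) i : set mR).
Proof. exact: measurable_itv. Qed.

Lemma measurable_fwd : measurable_fun [set: mR] (fwd : mR -> mR).
Proof.
apply: (@measurable_piecewise _
  (fun k i => if (i.+1 < ht k)%N then level (tower k) i else set0)
  (fun k i => ((slot k i.+1)%:R - (slot k i)%:R) * lwidth k)).
- by move=> k i; case: ifP => // _; exact: measurable_level.
- by move=> k i x; case: ifP => // hi xi; apply: fwdE; exact: levelI_step.
- move=> x hx; apply: xgetPN => y [k /column_mapP[i [hi xi _]]].
  by apply: (hx k i); rewrite hi.
Qed.

Lemma measurable_bwd : measurable_fun [set: mR] (bwd : mR -> mR).
Proof.
apply: (@measurable_piecewise _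
  (fun k i => if (i.+1 < ht k)%N then level (tower k) i.+1 else set0)
  (fun k i => ((slot k i)%:R - (slot k i.+1)%:R) * lwidth k)).
- by move=> k i; case: ifP => // _; exact: measurable_level.
- move=> k i y; case: ifP => // hi yi; apply: bwdE.
  have := levelI_step hi ((level_translate y hi (ltnW hi)).1 yi).
  by rewrite -addrA -mulrDl addrA addrNK subrr mul0r addr0.
- move=> y hy; apply: xgetPN => x [k /column_mapP[i [hi xi yE]]].
  apply: (hy k i); rewrite hi yE.
  exact: (level_translate x (ltnW hi) hi).1 xi.
Qed.

(** * Invariance of the measure *)

Definition stage_dom k : set mR :=
  \bigcup_i (if (i.+1 < ht k)%N then level (tower k) i else set0).
Definition stage_ran k : set mR :=
  \bigcup_i (if (i.+1 < ht k)%N then level (tower k) i.+1 else set0).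

Lemma stage_domP k x : stage_dom k x <-> exists y, column_map (tower k) x y.
Proof.
split=> [[i _]|[y /column_mapP[i [hi xi _]]]].
  by case: ifP => // hi xi; eexists; apply/column_mapP; exists i.
by exists i => //; rewrite hi.
Qed.

Lemma stage_ranP k y : stage_ran k y <-> exists x, column_map (tower k) x y.
Proof.
split=> [[i _]|[x /column_mapP[i [hi xi ->]]]].
  case: ifP => // hi yi.
  exists (y + ((slot k i)%:R - (slot k i.+1)%:R) * lwidth k).
  apply/column_mapP; exists i; split => //.
    exact: (level_translate y hi (ltnW hi)).1 yi.
  by rewrite -addrA -mulrDl addrA addrNK subrr mul0r addr0.
exists i => //; rewrite hi.
exact: (level_translate x (ltnW hi) hi).1 xi.
Qed.

Lemma measurable_stage_dom k : measurable (stage_dom k).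
Proof.
by apply: bigcupT_measurable => i; case: ifP => // _; exact: measurable_level.
Qed.

Lemma measurable_stage_ran k : measurable (stage_ran k).
Proof.
by apply: bigcupT_measurable => i; case: ifP => // _; exact: measurable_level.
Qed.

Lemma measurable_fwd_preimage (A : set mR) :
  measurable A -> measurable (fwd @^-1` A : set mR).
Proof.
by move=> mA; rewrite -[X in measurable X]setTI; exact: measurable_fwd.
Qed.

(** [stage_dom] omits the top level and [stage_ran] the bottom one; between them [fwd] translates
    each level onto the next. *)
Lemma lebesgue_stage k (A : set mR) : measurable A ->
  lambda (fwd @^-1` A `&` stage_dom k) = lambda (A `&` stage_ran k).
Proof.
move=> mA; rewrite /stage_dom /stage_ran !setI_bigcupr.
rewrite !measure_bigcup //=.
- apply: eq_eseriesr => i _; case: ifP => hi; last by rewrite !setI0.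
  pose c := ((slot k i.+1)%:R - (slot k i)%:R) * lwidth k.
  rewrite -[RHS](lebesgue_measure_addr c); last first.
    by apply: measurableI => //; exact: measurable_level.
  congr (lambda _); apply/seteqP; split=> x /= [Ax xi].
    have xi' := (level_translate x (ltnW hi) hi).1 xi.
    by rewrite -(fwdE (levelI_step hi xi)) in xi' *.
  have xi' := (level_translate x (ltnW hi) hi).2 xi.
  by split=> //; rewrite (fwdE (levelI_step hi xi')).
- move=> i _; case: ifP => _; last by rewrite setI0.
  by apply: measurableI => //; exact: measurable_level.
- move=> i j _ _ [x [[_ +] [_ +]]]; case: ifP => // hi xi; case: ifP => // hj xj.
  by case: (level_uniq hi hj xi xj).
- move=> i _; case: ifP => _; last by rewrite setI0.
  by apply: measurableI; [exact: measurable_fwd_preimage|exact: measurable_level].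
- move=> i j _ _ [x [[_ +] [_ +]]]; case: ifP => // hi xi; case: ifP => // hj xj.
  exact: (level_uniq (ltnW hi) (ltnW hj) xi xj).
Qed.

Lemma space_stage_dom : space = \bigcup_k stage_dom k.
Proof.
apply/seteqP; split=> x /=.
  by move=> /step_total[y [k xy]]; exists k => //; apply/stage_domP; exists y.
move=> [k _ /stage_domP[y xy]].
by have [] := @step_space x y (ex_intro _ k xy).
Qed.

Lemma space_stage_ran : space `\ 0%R = \bigcup_k stage_ran k.
Proof.
apply/seteqP; split=> y /=.
  move=> [sy /eqP y0]; have [x [k xy]] := step_onto sy y0.
  by exists k => //; apply/stage_ranP; exists x.
move=> [k _ /stage_ranP[x xy]].
by have [_ ? /eqP] := @step_space x y (ex_intro _ k xy).
Qed.

Lemma measurable_space : measurable (space : set mR).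
Proof. exact: measurable_rank_one_space. Qed.

(** The domains of the column maps increase to the space and their ranges to the space without 0;
    continuity from below passes [lebesgue_stage] to the limit. *)
Lemma mu_fwd (A : set mR) : measurable A -> mu (fwd @^-1` A) = mu A.
Proof.
move=> mA; rewrite /= /mrestr.
have mfA := measurable_fwd_preimage mA.
have incl (F : nat -> set mR) (B : set mR) : measurable B ->
    (forall k, measurable (F k)) -> (forall k, F k `<=` F k.+1) ->
    lambda (B `&` F k) @[k --> \oo] --> lambda (B `&` \bigcup_k F k).
  move=> mB mF ndF; rewrite setI_bigcupr.
  apply: (@nondecreasing_cvg_mu _ _ _ lambda (fun k => B `&` F k)).
  - by move=> k; exact: measurableI.
  - by apply: bigcupT_measurable => k; exact: measurableI.
  - apply/nondecreasing_seqP => k; apply/subsetPset.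
    by apply: setIS; exact: ndF.
have h1 := incl stage_dom _ mfA measurable_stage_dom.
have h2 := incl stage_ran _ mA measurable_stage_ran.
have {}h1 : lambda (A `&` stage_ran k) @[k --> \oo] -->
    lambda (fwd @^-1` A `&` \bigcup_k stage_dom k).
  rewrite (_ : (fun k => _) = (fun k => lambda (fwd @^-1` A `&` stage_dom k))).
    apply: h1 => k x /stage_domP[y /column_mapS xy].
    by apply/stage_domP; exists y.
  by apply/funext => k; rewrite lebesgue_stage.
(* The point 0, missed by all ranges, has measure zero. *)
have -> : lambda (A `&` space) = lambda (A `&` (space `\ 0%R)).
  have m0 : measurable ([set 0%R] : set mR) by exact: measurable_set1.
  have mAs : measurable (A `&` space : set mR).
    by apply: measurableI => //; exact: measurable_space.
  rewrite setIDA [LHS](measureDI lambda mAs m0).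
  rewrite [X in (_ + X)%E](_ : _ = 0%E) ?adde0 //.
  apply: subset_measure0 (lebesgue_measure_set1 0) => //.
  exact: measurableI.
rewrite space_stage_ran [in LHS]space_stage_dom.
apply: cvg_unique h1 (h2 _) => //.
by move=> k y /stage_ranP[x /column_mapS xy]; apply/stage_ranP; exists x.
Qed.

(** * Null sets and the nonsingular transformation *)

Lemma muE (A : set mR) : mu A = lambda (A `&` space).
Proof. by []. Qed.

Lemma mu_sub (A : set mR) : A `<=` space -> mu A = lambda A.
Proof. by move=> /setIidPl; rewrite muE => ->. Qed.

Lemma level_space k i : (i < ht k)%N -> level (tower k) i `<=` space.
Proof. by move=> hi x xi; apply/spaceP; exists k, i. Qed.

Lemma lebesgue_level k i : lambda (level (tower k) i) = (lwidth k)%:E.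
Proof.
rewrite /level lebesgue_measure_itv /= lte_fin ltrDl lwidth_gt0.
by rewrite -EFinD addrAC subrr add0r.
Qed.

Let ae_filter : Filter (almost_everywhere mu).
Proof. exact: ae_filter_ringOfSetsType. Qed.

Lemma ae_space : {ae mu, forall x, space x}.
Proof.
exists (~` space); split => //.
  by apply: measurableC; exact: measurable_space.
by rewrite /= /mrestr setICl measure0.
Qed.

Lemma ae_neq (a : R) : {ae mu, forall x, x != a}.
Proof.
exists [set a]; split; first exact: measurable_set1.
  rewrite /= /mrestr; apply: subset_measure0 (lebesgue_measure_set1 a) => //.
  by apply: measurableI; [exact: measurable_set1|exact: measurable_space].
by move=> x /= /negP; rewrite negbK => /eqP.
Qed.

Lemma ae_fwdK : {ae mu, forall x, bwd (fwd x) = x}.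
Proof. by apply: (@filterS _ _ ae_filter) ae_space => x /fwd_step/bwdE. Qed.

Lemma ae_bwdK : {ae mu, forall y, fwd (bwd y) = y}.
Proof.
apply: (@filterS2 _ _ ae_filter) ae_space (ae_neq 0) => y sy y0.
exact/fwdE/bwd_step.
Qed.

Definition tower_map : nonsingular_transformation mu :=
  Nonsingular measurable_fwd measurable_bwd ae_fwdK ae_bwdK
    (fun A mA => let e := mu_fwd mA in
     conj (fun h => etrans e h) (fun h => etrans (esym e) h)).

Lemma tower_map_measure_preserving : measure_preserving tower_map.
Proof. by move=> A mA; exact: mu_fwd. Qed.

Lemma mu_sigma_finite : sigma_finite setT mu.
Proof.
have [F FT hF] := sigma_finiteT lambda.
exists F => // i; have [mF lF] := hF i; split => //.
apply: le_lt_trans lF; rewrite muE; apply: le_measure => //; rewrite ?inE //.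
by apply: measurableI => //; exact: measurable_space.
Qed.

Lemma pos_pick d (X : measurableType d) (m : {measure set X -> \bar R})
    (A N : set X) : measurable A -> (0 < m A)%E ->
  m.-negligible N -> exists2 x, A x & ~ N x.
Proof.
move=> mA A0 nN; apply: contrapT => h; have : m A = 0%E.
  apply: measure_negligible => //; apply: negligibleS nN => x Ax.
  by apply: contrapT => nx; apply: h; exists x.
by move=> e; move: A0; rewrite e ltxx.
Qed.

Lemma measurable_iterz n : measurable_fun [set: mR] (iterz tower_map n).
Proof.
have it (f : mR -> mR) m : measurable_fun [set: mR] f ->
    measurable_fun [set: mR] (iter m f).
  move=> mf; elim: m => [|m IH]; first exact: measurable_id.
  exact: (measurableT_comp mf IH).
by case: n => m; apply: it; [exact: measurable_fwd|exact: measurable_bwd].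
Qed.

Lemma measurable_imagez n (A : set mR) :
  measurable A -> measurable (imagez tower_map n A).
Proof.
by move=> mA; rewrite -[X in measurable X]setTI; exact: measurable_iterz.
Qed.

(** * Failure of weak double ergodicity *)

(** Backward steps from these points end at 0, where [bwd] no longer inverts [fwd]. They are
    countably many. *)
Definition in_orbit0 x := exists m, x = iter m fwd 0.

Lemma ae_not_orbit0 : {ae mu, forall x, ~ in_orbit0 x}.
Proof.
apply: (@negligibleS _ _ _ mu (\bigcup_m [set iter m fwd 0])).
  by move=> x /= /contrapT[m ->]; exists m.
apply: negligible_bigcup => m; apply: negligibleS (ae_neq (iter m fwd 0)).
by move=> x /= ->; rewrite eqxx.
Qed.

Lemma iter_bwdK m x : space x -> ~ in_orbit0 x ->
  space (iter m bwd x) /\ iter m fwd (iter m bwd x) = x.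
Proof.
elim: m x => //= m IH x sx nx.
have x0 : x != 0 by apply/eqP => x0; apply: nx; exists 0%N.
have st := bwd_step sx x0; have [sx' _ _] := step_space st.
have nx' : ~ in_orbit0 (bwd x).
  by move=> [j hj]; apply: nx; exists j.+1; rewrite -(fwdE st) hj.
by have [] := IH _ sx' nx'; rewrite -iterSr iterS => ? ->; rewrite (fwdE st).
Qed.

(** Each step is made by some column map and by all later ones, so from some stage on the m steps
    stay inside one column without crossing its top. *)
Lemma iter_fwd_eventually m x : space x -> exists K, forall k, (K <= k)%N ->
  exists i, [/\ (i + m < ht k)%N, level (tower k) i x &
                level (tower k) (i + m) (iter m fwd x)].
Proof.
move=> sx; elim: m => [|m [K hK]].
  have [K hK] := space_level sx; exists K => k /hK[i hi xi].
  by exists i; rewrite addn0.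
have [k1 xk1] := fwd_step (iter_fwd_space m sx).
exists (maxn K k1) => k; rewrite geq_max => /andP[/hK[i [hi xi xim]] hk1].
move: (column_map_le hk1 xk1) => /column_mapP[j [hj xj _]].
have ij := level_uniq (ltnW hj) hi xj xim; rewrite ij -addnS in hj.
by exists i; split => //; have [] := iter_fwd_level hj xi.
Qed.

Lemma slot_base k i x : (i < ht k)%N -> level (tower k) i x ->
  level (tower 0) 0 x -> descendant k i.
Proof.
move=> hi /(levelP _ hi)/andP[x1 _] /(levelP _ (isT : (0 < ht 0)%N))/andP[_].
rewrite slot0 mul1r /lwidth expr0 invr1 => x2.
apply: descendant_slot => //; move: (le_lt_trans x1 x2).
by rewrite -[ltRHS](exp_lwidth k) ltr_pM2r ?lwidth_gt0 // ltr_nat.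
Qed.

Lemma slot_base_shift k i x : (i < ht k.+1)%N -> level (tower k.+1) i x ->
  level (tower 1) 1 x -> exists2 j, descendant k.+1 j & i = j.+1.
Proof.
move=> hi /(levelP _ hi)/andP[x1 x2] /(levelP _ (isT : (1 < ht 1)%N)).
have v0 := lwidth_gt0 k.+1.
(* Level 1 of C_1 is [1, 3/2[; its right end is expressed in widths of C_(k+1). *)
have [e1 e2] : 2 * lwidth 1 = 1 /\ 3 * lwidth 1 = (3 * 2 ^ k)%:R * lwidth k.+1.
  have := lwidthS 0; have := exp_lwidth 0.
  have := mul_lwidth k (2 ^ k); have := exp_lwidth k.
  rewrite !natrM expn0 mul1r => -> e -> ?; split; lra.
rewrite (_ : slot 1 1 = 2%N) // e1 e2 => /andP[x3 x4].
apply: descendant_slot_shift => //.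
  move: (le_lt_trans x3 x2).
  by rewrite -[ltLHS](exp_lwidth k.+1) ltr_pM2r // ltr_nat.
by move: (le_lt_trans x1 x4); rewrite ltr_pM2r // ltr_nat.
Qed.

Lemma tower_map_not_wde : ~ weakly_doubly_ergodic tower_map.
Proof.
pose A : set mR := level (tower 0) 0; pose B : set mR := level (tower 1) 1.
have mA : measurable A by exact: measurable_level.
have mB : measurable B by exact: measurable_level.
have A0 : (0 < mu A)%E.
  by rewrite mu_sub ?lebesgue_level ?lte_fin ?lwidth_gt0 //; exact: level_space.
have B0 : (0 < mu B)%E.
  by rewrite mu_sub ?lebesgue_level ?lte_fin ?lwidth_gt0 //; exact: level_space.
move=> /(_ A B mA mB A0 B0)[n].
have nN := @filterI _ _ ae_filter _ _ ae_space ae_not_orbit0.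
have mI := measurable_imagez n mA.
move=> [/(pos_pick (measurableI _ _ mI mA))/(_ nN)[x [Ax' Ax] /contrapT[sx ox]]].
move=> /(pos_pick (measurableI _ _ mI mB))/(_ nN)[y [Ay' By] /contrapT[sy oy]].
(* T^n A is a preimage under T^(-n), so the sign of - n decides between forward and backward
   steps. *)
move: Ax' Ay'; rewrite /imagez /=; case: (- n) => m /=.
  move=> Ax' Ay'.
  have [K hK] := iter_fwd_eventually m sx.
  have [L hL] := iter_fwd_eventually m sy.
  (* The successor is there because [slot_base_shift] speaks of C_1 and later columns. *)
  have [|i [hi xi xi']] := hK (maxn K L).+1; first by rewrite leqW ?leq_maxl.
  have [|j [hj yj yj']] := hL (maxn K L).+1; first by rewrite leqW ?leq_maxr.
  have hi0 := leq_ltn_trans (leq_addr m i) hi.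
  have hj0 := leq_ltn_trans (leq_addr m j) hj.
  have [b db jb] := slot_base_shift hj0 yj By.
  (* Through x, m is a difference of two descendants; through y, it is a descendant minus b + 1. *)
  apply: (descendant_diff (slot_base hi0 xi Ax) (slot_base hi xi' Ax') db
    (slot_base hj yj' Ay')); lia.
rewrite -!iterS => Ax' Ay'.
(* Starting from the backward images turns this case into one about forward steps. *)
have [sx' xE] := iter_bwdK m.+1 sx ox; have [sy' yE] := iter_bwdK m.+1 sy oy.
have [K hK] := iter_fwd_eventually m.+1 sx'.
have [L hL] := iter_fwd_eventually m.+1 sy'.
rewrite xE in hK; rewrite yE in hL.
have [|i [hi xi xi']] := hK (maxn K L).+1; first by rewrite leqW ?leq_maxl.
have [|j [hj yj yj']] := hL (maxn K L).+1; first by rewrite leqW ?leq_maxr.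
have hi0 := leq_ltn_trans (leq_addr m.+1 i) hi.
have hj0 := leq_ltn_trans (leq_addr m.+1 j) hj.
have [b db jb] := slot_base_shift hj yj' By.
apply: (descendant_diff (slot_base hi xi' Ax) (slot_base hi0 xi Ax') db
  (slot_base hj0 yj Ay')); lia.
Qed.
(** * Isometric coefficients *)

Lemma level_subset_ball k i x : (i < ht k)%N -> level (tower k) i x ->
  level (tower k) i `<=` ball x (lwidth k).
Proof.
move=> hi /(levelP _ hi)/andP[+ +] y /(levelP _ hi)/andP[].
by rewrite -natr1 mulrDl mul1r /ball /= ltr_norml => *; apply/andP; split; lra.
Qed.

(** Lebesgue density: around a density point x, A fills most of the ball of radius 2^-k, which
    contains the level of C_k through x and is only twice as long. *)
Lemma dense_level (A : set mR) : measurable A -> (0 < mu A)%E ->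
  exists K, forall k, (K <= k)%N -> exists2 i, (i < ht k)%N &
    (lambda (level (tower k) i `\` A) < (lwidth k / 8)%:E)%E.
Proof.
move=> mA A0.
have mAs : measurable (A `&` space : set mR).
  by apply: measurableI => //; exact: measurable_space.
have [x [Ax sx] /contrapT] := pos_pick mAs A0 (lebesgue_density mA).
(* Missing 1/16 of the ball, of length 2 * 2^-k, amounts to 1/8 of the level. *)
rewrite /= indicE mem_set //= => /fine_cvg /cvgr_gt /(_ (15 / 16)) [|e /= e0 he].
  by rewrite ltr_pdivrMr ?mul1r ?ltr_nat.
have [K hK] := space_level sx; have [L hL] := lwidth_lt e0.
exists (maxn K L) => k; rewrite geq_max => /andP[/hK[i hi xi] /hL ke].
exists i => //.
have r0 := lwidth_gt0 k.
have := he (lwidth k); rewrite /ball /= sub0r normrN gtr0_norm // => /(_ ke r0).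
set B : set mR := ball x (lwidth k).
have mB : measurable B by exact: measurable_ball.
have lB : lambda B = (lwidth k *+ 2)%:E by rewrite lebesgue_measure_ball // ltW.
have mAB : measurable (A `&` B) by exact: measurableI.
have fAB : lambda (A `&` B) \is a fin_num.
  rewrite ge0_fin_numE //; apply: (@le_lt_trans _ _ (lambda B)).
    by apply: le_measure; rewrite ?inE //; exact: subIsetr.
  by rewrite lB ltry.
rewrite lB inver mulrn_eq0 /= gt_eqF // -(fineK fAB) -EFinM /=.
rewrite ltr_pdivlMr ?mulrn_wgt0 // => hAB.
apply: (@le_lt_trans _ _ (lambda (B `\` A))).
  apply: le_measure; rewrite ?inE.
  - by apply: measurableD => //; exact: measurable_level.
  - exact: measurableD.
  - by apply: setSD; exact: level_subset_ball.
have -> : lambda (B `\` A) = (lambda B - lambda (B `&` A))%E.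
  by apply: measureD => //; rewrite [X in (X < _)%E]lB ltry.
rewrite lB setIC -(fineK fAB) -EFinB lte_fin.
by move: hAB; rewrite mulr2n; lra.
Qed.

(** The points of J outside A, those translated outside A' and those in N together measure less than
    v/8 + v/8, so they cannot exhaust J. *)
Lemma overlap (A A' N I I' J : set mR) (c v : R) :
  measurable A -> measurable A' -> mu.-negligible N ->
  measurable I -> measurable I' -> measurable J ->
  J `<=` I -> (forall x, J x -> I' (x + c)) -> J `<=` space ->
  ((v / 4)%:E <= lambda J)%E ->
  (lambda (I `\` A) < (v / 8)%:E)%E -> (lambda (I' `\` A') < (v / 8)%:E)%E ->
  exists x, [/\ J x, A x, A' (x + c) & ~ N x].
Proof.
move=> mA mA' [N0 [mN0 N00 NN0]] mI mI' mJ JI JI' Js lJ lIA lIA'.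
apply: contrapT => h.
pose F : set mR := (fun x : mR => x + c : mR) @^-1` (I' `\` A').
have mF : measurable F.
  rewrite -[X in measurable X]setTI; apply: measurable_addr => //.
  exact: measurableD.
have mIA : measurable (I `\` A) by exact: measurableD.
(* N0 is null for [mu], so its Lebesgue measure vanishes only inside the space, which contains J. *)
have mN : measurable (N0 `&` space : set mR).
  by apply: measurableI => //; exact: measurable_space.
have sub : J `<=` ((I `\` A) `|` F) `|` (N0 `&` space).
  move=> x Jx.
  have [Nx|Nx] := pselect (N x); first by right; split; [exact: NN0|exact: Js].
  have [Ax|Ax] := pselect (A x); last by left; left; split => //; exact: JI.
  have [A'x|A'x] := pselect (A' (x + c)); first by case: h; exists x.
  by left; right; split => //; exact: JI'.
suff : (lambda J < (v / 4)%:E)%E by rewrite ltNge lJ.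
have mIF : measurable ((I `\` A) `|` F) by exact: measurableU.
apply: (@le_lt_trans _ _ (lambda (I `\` A) + lambda F)%E).
  apply: (@le_trans _ _ (lambda (((I `\` A) `|` F) `|` (N0 `&` space)))).
    by apply: le_measure; rewrite ?inE //; exact: measurableU.
  apply: le_trans (measureU2 lambda mIF mN) _.
  rewrite [X in (_ + X)%E](_ : _ = 0%E) ?adde0; last exact: N00.
  exact: measureU2.
rewrite (_ : lambda F = lambda (I' `\` A')); last first.
  by apply: lebesgue_measure_addr; exact: measurableD.
by apply: lt_le_trans (lteD lIA lIA') _; rewrite -EFinD lee_fin; lra.
Qed.

Lemma mu_iter_fwd n (A : set mR) : measurable A ->
  measurable (iter n fwd @^-1` A : set mR) /\ mu (iter n fwd @^-1` A) = mu A.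
Proof.
elim: n A => //= n IH A mA; have mfA := measurable_fwd_preimage mA.
by have [] := IH _ mfA; rewrite (mu_fwd mA).
Qed.

Lemma ae_orbit (P : R -> Prop) : {ae mu, forall x, P x} ->
  {ae mu, forall x, forall n, P (iter n fwd x)}.
Proof.
move=> [N [mN N0 PN]]; apply: ae_foralln => n.
have [mN' N0'] := mu_iter_fwd n mN.
exists (iter n fwd @^-1` N); split => //; first by rewrite N0'.
by move=> x /= nPx; apply: PN.
Qed.

(** Two columns ahead both return times are visible: the leftmost quarter of a level, moved up by
    p_k or by p_(k+1), is again a quarter of that level. *)
Lemma level_refine k i : (i < ht k)%N ->
  [/\ level (tower k.+2) i `<=` level (tower k) i,
      level (tower k.+2) (i + rtime k) `<=` level (tower k) i &
      level (tower k.+2) (i + rtime k.+1) `<=` level (tower k) i].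
Proof.
move=> hi; have h1 : (i < ht k.+1)%N by rewrite htS; lia.
have h2 : (i + rtime k < ht k.+1)%N by rewrite htS; lia.
split=> x xi; apply/(level_split _ hi).
- by left; apply/(level_split _ h1); left.
- by right; apply/(level_split _ h2); left.
- by left; apply/(level_split _ h1); right.
Qed.

(** * Maps intertwining T with an isometry *)

Section isometric_coefficients.
Context (Y : metricType R) (S : Y -> Y) (phi : mR -> Y).
Hypotheses (sepY : separable Y) (isoS : Defs.isometry S) (bphi : borel_fun phi).
Hypothesis eq_phi : {ae mu, forall x, S (phi x) = phi (fwd x)}.

Lemma mball_open (y : Y) (e : R) : open (ball y e).
Proof.
rewrite openE => z; rewrite ballEmdist /= => yz.
apply/nbhs_ballP; exists (e - mdist y z) => /=; first by rewrite subr_gt0.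
move=> t; rewrite !ballEmdist /=; have := metric_triangle y z t; lra.
Qed.

Definition near_set (d : Y) (e : R) : set mR := phi @^-1` ball d e.

Lemma measurable_near_set d e : measurable (near_set d e).
Proof. by apply: bphi; apply: sub_sigma_algebra; exact: mball_open. Qed.

Lemma near_setP d e x : near_set d e x <-> mdist d (phi x) < e.
Proof. by rewrite /near_set /= ballEmdist. Qed.

(** By separability countably many balls of radius e cover Y, and those with null preimage can be
    discarded together. *)
Lemma ae_near_center (e : R) : 0 < e ->
  {ae mu, forall x, exists2 d, near_set d e x & (0 < mu (near_set d e))%E}.
Proof.
move=> e0; have [D cD dD] := sepY.
move: cD => /pfcard_geP[D0|[f]].
  (* An empty D is not dense, as Y contains [phi 0]. *)
  have [] := dD (ball (phi 0) e).
  - by exists (phi 0); exact: ballxx.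
  - exact: mball_open.
  - by move=> z; rewrite D0 => -[].
pose F n : set mR :=
  if (0 < mu (near_set (f n) e))%E then set0 else near_set (f n) e.
apply: (@negligibleS _ _ _ mu (\bigcup_n F n)); last first.
  apply: negligible_bigcup => n; rewrite /F; case: ifPn => [_|].
    exact: negligible_set0.
  rewrite -leNgt measure_le0 => /eqP h.
  by apply/negligibleP => //; exact: measurable_near_set.
move=> x /= nx.
have [z [xz Dz]] : ball (phi x) e `&` D !=set0.
  by apply: dD; [exists (phi x); exact: ballxx|exact: mball_open].
have [n _ fz] := @surj _ _ _ _ f z Dz.
have zx : near_set (f n) e x by rewrite fz; exact: ball_sym.
exists n => //; rewrite /F; case: ifPn => // h.
by exfalso; apply: nx; exists (f n).
Qed.

Lemma iso_iter n (y z : Y) : mdist (iter n S y) (iter n S z) = mdist y z.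
Proof. by elim: n => //= n IH; rewrite isoS. Qed.

Lemma ae_phi_orbit :
  {ae mu, forall x, forall n, phi (iter n fwd x) = iter n S (phi x)}.
Proof.
apply: (@filterS _ _ ae_filter) (ae_orbit eq_phi) => x hx n.
by elim: n => //= n IH; rewrite -hx IH.
Qed.

(** If x and T^p x both lie in [near_set d e], then S^p (phi x) = phi (T^p x) is within e of both
    S^p d and d. *)
Lemma iso_near_return d e : (0 < mu (near_set d e))%E ->
  exists k, mdist (iter (rtime k) S d) d < 2 * e /\
            mdist (iter (rtime k.+1) S d) d < 2 * e.
Proof.
move=> V0; have mV := measurable_near_set d e.
have [k /(_ _ (leqnn k))[i hi dens]] := dense_level mV V0; exists k.
have [sub0 sub1 sub2] := level_refine hi.
have mI := measurable_level k i; have mJ := measurable_level k.+2 i.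
have ret p : (i + p < ht k.+2)%N ->
    level (tower k.+2) (i + p) `<=` level (tower k) i ->
    mdist (iter p S d) d < 2 * e.
  move=> hp subp; have hi2 := leq_ltn_trans (leq_addr p i) hp.
  have [|||x [Jx xV xcV /contrapT hx]] := @overlap _ _ _ _ _ _
      (((slot k.+2 (i + p))%:R - (slot k.+2 i)%:R) * lwidth k.+2) (lwidth k)
      mV mV ae_phi_orbit mI mI mJ sub0 _ _ _ dens dens.
  - by move=> x xi; apply: subp; exact: (level_translate x hi2 hp).1 xi.
  - by move=> x xi; exact: level_space xi.
  (* A level of C_(k+2) is exactly a quarter of a level of C_k, as much as [overlap] asks for. *)
  - by rewrite lebesgue_level lee_fin (lwidthS k) (lwidthS k.+1); lra.
  move: xcV; rewrite -(iter_fwd_level hp Jx).2 => /near_setP.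
  rewrite hx => h1; move: xV => /near_setP; rewrite -(iso_iter p) => h2.
  have := metric_triangle (iter p S d) (iter p S (phi x)) d.
  by rewrite (metric_sym (iter p S (phi x)) d); lra.
by split; apply: ret => //; rewrite !htS /rtime /=; lia.
Qed.

Lemma iso_mulr p n (y : Y) (e : R) : mdist (iter p S y) y < e ->
  mdist (iter (n * p) S y) y <= n%:R * e.
Proof.
move=> h; elim: n => [|n IH]; first by rewrite mdistxx mul0r.
rewrite mulSn iterD -natr1 mulrDl mul1r.
have := metric_triangle (iter p S (iter (n * p) S y)) (iter p S y) y.
by rewrite iso_iter; lra.
Qed.

(** S^(3 p_k) moves d by at most 6 e and S^(3 p_k + 1) by less than 2 e; the two differ by one
    application of S. *)
Lemma iso_almost_fixed d e :
  (0 < mu (near_set d e))%E -> mdist (S d) d <= 8 * e.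
Proof.
move=> /iso_near_return[k []]; rewrite rtimeS.
move=> /(iso_mulr 3) h1; rewrite iterS => h2.
have := metric_triangle (S d) (S (iter (3 * rtime k) S d)) d.
by rewrite isoS (metric_sym d); lra.
Qed.

(** Radii run through 1/(n + 1) because only countably many almost-everywhere statements can be
    combined. *)
Lemma mdist_eq0_harmonic (y z : Y) (c : R) :
  (forall n, mdist y z <= c * n.+1%:R^-1) -> y = z.
Proof.
move=> h; apply: mdist_positivity; apply/eqP; rewrite eq_le mdist_ge0 andbT.
apply/ler_addgt0Pl => e e0; rewrite addr0.
apply: le_trans (h (Num.truncn (c / e))) _.
rewrite ler_pdivrMr ?ltr0n // mulrC -ler_pdivrMr // ltW //.
exact: Num.Theory.truncnS_gt.
Qed.

Lemma ae_phi_inv : {ae mu, forall x, phi (fwd x) = phi x}.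
Proof.
(* 10 = 1 + 8 + 1: from S (phi x) to S d, to d, to phi x. *)
have aen (e : R) : 0 < e ->
    {ae mu, forall x, mdist (S (phi x)) (phi x) <= 10 * e}.
  move=> e0.
  apply: (@filterS _ _ ae_filter) (ae_near_center e0) => x [d].
  move=> /near_setP xd /iso_almost_fixed dd.
  have := metric_triangle (S (phi x)) (S d) (phi x).
  have := metric_triangle (S d) d (phi x).
  by rewrite isoS (metric_sym (phi x) d); lra.
have e0 n : 0 < n.+1%:R^-1 :> R by rewrite invr_gt0 ltr0n.
have aeN := ae_foralln (fun n => aen _ (e0 n)).
apply: (@filterS2 _ _ ae_filter) eq_phi aeN => x <- hx.
exact: mdist_eq0_harmonic hx.
Qed.

Lemma ae_phi_inv_orbit :
  {ae mu, forall x, forall n, phi (iter n fwd x) = phi x}.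
Proof.
apply: (@filterS _ _ ae_filter) (ae_orbit ae_phi_inv) => x hx n.
by elim: n => //= n IH; rewrite hx IH.
Qed.

(** This is the ergodicity argument: in one column each of the two sets nearly fills a level, and
    climbing from the lower level to the higher one leaves phi unchanged. *)
Lemma near_centers_close d d' e :
  (0 < mu (near_set d e))%E -> (0 < mu (near_set d' e))%E ->
  mdist d d' < 2 * e.
Proof.
move=> V0 V0'.
have mV := measurable_near_set d e; have mV' := measurable_near_set d' e.
have [K hK] := dense_level mV V0; have [K' hK'] := dense_level mV' V0'.
have [i hi dens] := hK _ (leq_maxl K K').
have [j hj dens'] := hK' _ (leq_maxr K K').
set k := maxn K K' in hi hj dens dens'; move: k hi hj dens dens' => k {hK hK'}.
(* The conclusion is symmetric in d and d', so the level of d may be taken as the lower one. *)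
wlog ij : i j d d' V0 V0' mV mV' / (i <= j)%N.
  move=> h hi hj di dj; have [ij|/ltnW ij] := leqP i j; first exact: h hi hj di dj.
  by rewrite metric_sym; apply: h hj hi dj di.
move=> hi hj dens dens'.
have hp : (i + (j - i) < ht k)%N by rewrite subnKC.
have mI := measurable_level k i; have mI' := measurable_level k j.
have [|||x [Jx xV xcV /contrapT hx]] := @overlap _ _ _ _ _ _
    (((slot k (i + (j - i)))%:R - (slot k i)%:R) * lwidth k) (lwidth k)
    mV mV' ae_phi_inv_orbit mI mI' mI (@subset_refl _ _) _ _ _ dens dens'.
- move=> x xi; rewrite -[j in level _ j](subnKC ij).
  exact: (level_translate x hi hp).1 xi.
- exact: level_space.
- by rewrite lebesgue_level lee_fin; have := lwidth_gt0 k; lra.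
move: xcV; rewrite -(iter_fwd_level hp Jx).2 => /near_setP; rewrite hx => h1.
move: xV => /near_setP h2; have := metric_triangle d (phi x) d'.
by rewrite (metric_sym (phi x) d'); lra.
Qed.

(** The constant is the value at one point x0 that is good for all radii 1/(n + 1) at once. *)
Lemma phi_constant : exists c : Y, {ae mu, forall x, phi x = c}.
Proof.
have e0 n : 0 < n.+1%:R^-1 :> R by rewrite invr_gt0 ltr0n.
have aec := ae_foralln (fun n => ae_near_center (e0 n)).
have A0 : (0 < mu (level (tower 0) 0))%E.
  by rewrite mu_sub ?lebesgue_level ?lte_fin ?lwidth_gt0 //; exact: level_space.
have [x0 _ /contrapT hx0] := pos_pick (measurable_level 0 0) A0 aec.
exists (phi x0); apply: (@filterS _ _ ae_filter) aec => x hx.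
(* 4 = 1 + 2 + 1: from phi x to d, to d', to phi x0. *)
apply: (@mdist_eq0_harmonic _ _ 4) => n.
have [d /near_setP xd d0] := hx n; have [d' /near_setP xd' d0'] := hx0 n.
move: (n.+1%:R^-1) xd xd' d0 d0' => e xd xd' d0 d0'.
have := near_centers_close d0 d0'.
have := metric_triangle (phi x) d (phi x0).
have := metric_triangle d d' (phi x0).
by rewrite (metric_sym (phi x) d); lra.
Qed.

End isometric_coefficients.

End realization.

Theorem theorem3p1 (R : realType) :
  exists (C : nat -> column R) (r : nat -> nat) (s : nat -> nat -> nat)
         (T : nonsingular_transformation (rank_one_measure C)),
    [/\ rank_one_construction C r s,
        rank_one_limit C T,
        sigma_finite setT (rank_one_measure C) &
        measure_preserving T] /\
    ~ weakly_doubly_ergodic T /\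
    ergodic_isometric_coefficients T.
Proof.
exists (@tower R), (fun=> 2%N).
exists (fun k i => if i == 0%N then (ht k + k)%N else 0%N), (@tower_map R).
split; [split|split].
- exact: tower_construction.
- exact: tower_limit.
- exact: mu_sigma_finite.
- exact: tower_map_measure_preserving.
- exact: tower_map_not_wde.
- by move=> Y S phi sepY isoS _ bphi; exact: phi_constant.
Qed.
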